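(* Let $K$ be a field of any characteristic and let $X=\{x_1,x_2,\ldots\}$ be a finite or countable set with more than one element. The polynomials \[ f'_{ij}=[[x_i,x_j],x_j],\quad f''_{ij}=[x_i,[x_i,x_j]],\quad i>j, \] \[ g'_{ijk}=[x_i,[x_j,x_k]],\quad g''_{ikj}=[[x_i,x_k],x_j],\quad i>j>k, \] \[ h_{ijk}=[[x_i,x_j],[x_i,x_k]],\quad i>j>k, \] (where all indices refer to elements of $X$) form a Gröbner basis, with respect to the deg-lex ordering, of the ideal $I=K\langle X\rangle\,\gamma_3(L)\,K\langle X\rangle$.
   Context: $K\langle X\rangle$ is the free unitary associative $K$-algebra on $X$; $\langle X\rangle$ is its set of words (monomials). $[f,g]=fg-gf$. $L=L(X)$ is the Lie subalgebra of $K\langle X\rangle$ generated by $X$ under the commutator (the free Lie algebra on $X$), and $\gamma_3(L)=[L,L,L]=[[L,L],L]$ is the third member of its lower central series; $I$ is the two-sided ideal of $K\langle X\rangle$ generated by $\gamma_3(L)$. Deg-lex ordering on $\langle X\rangle$: monomials are compared first by total degree and then lexicographically, reading from left to right, with $x_1<x_2<\cdots$. For nonzero $f\in K\langle X\rangle$, $\mathrm{lt}(f)$ is the greatest monomial occurring in $f$ (with nonzero coefficient). A subset $G$ of a two-sided ideal $I$ is a Gröbner basis of $I$ if for every nonzero $f\in I$ there is a $g\in G$ such that $\mathrm{lt}(g)$ is a subword (contiguous factor) of $\mathrm{lt}(f)$. *)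

(* Defs.v *)
From HB Require Import structures.
From mathcomp Require Import all_boot all_order all_algebra.
From mathcomp Require Import finmap monalg.

Set Implicit Arguments.
Unset Strict Implicit.
Unset Printing Implicit Defensive.

Import Order.TTheory GRing.Theory.
Local Open Scope ring_scope.

Section DegLex.

Context {d : Order.disp_t} {I : orderType d}.
Implicit Types u v w : {fmonom I}.

(* Lexicographic order on the pairs (degree, word). The words compared by
   [seqlexi] always have equal lengths, so its rule for proper prefixes plays
   no role. *)
Definition deglex u v : bool :=
  ((fdeg u, fmonom_val u) <= (fdeg v, fmonom_val v)
     :> (nat *l seqlexi I)%type)%O.

Lemma deglexE u v : deglex u v =
  (size u < size v)%N ||
  (size u == size v) && ((fmonom_val u : seqlexi I) <= fmonom_val v)%O.
Proof.
rewrite /deglex leEprodlexi /= /fdeg !leEnat.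
by case: ltngtP.
Qed.

Lemma deglex_total : total deglex.
Proof. by move=> u v; exact: le_total. Qed.

Lemma deglex_trans : transitive deglex.
Proof. by move=> v u w; exact: le_trans. Qed.

Lemma deglex_anti : antisymmetric deglex.
Proof. by move=> [u] [v] /le_anti [_ ->]. Qed.

End DegLex.

Section FreeAlgebra.

Context {K : fieldType} {d : Order.disp_t} {I : orderType d}.
Local Notation A := {malg K[{fmonom I}]}.
Implicit Types (f g h : A) (U V S : A -> Prop).

Definition x_ (i : I) : A := << fmu i >>.

Definition bracket f g : A := f * g - g * f.

Inductive span S : A -> Prop :=
| span_gen f of S f : span S f
| span0 : span S 0
| spanD f g of span S f & span S g : span S (f + g)
| spanZ (c : K) f of span S f : span S (c *: f).

Inductive freeLie : A -> Prop :=
| freeLie_gen i : freeLie (x_ i)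
| freeLie0 : freeLie 0
| freeLieD f g of freeLie f & freeLie g : freeLie (f + g)
| freeLieZ (c : K) f of freeLie f : freeLie (c *: f)
| freeLieB f g of freeLie f & freeLie g : freeLie (bracket f g).

Definition bracket_span U V : A -> Prop :=
  span (fun h => exists f g, [/\ U f, V g & h = bracket f g]).

Definition gamma3 : A -> Prop :=
  bracket_span (bracket_span freeLie freeLie) freeLie.

Definition ideal_gen U : A -> Prop :=
  span (fun h => exists a f b, U f /\ h = a * f * b).

(* At [f = 0], where the leading monomial is undefined, this is the empty
   word. *)
Definition lt_mon f : {fmonom I} :=
  last mone (sort deglex (enum_fset (msupp f))).

Lemma lt_mon_in f : f != 0 -> lt_mon f \in msupp f.
Proof.
rewrite -msupp_eq0 -cardfs_eq0 -lt0n cardfE => nz.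
rewrite -[_ \in _]/(_ \in enum_fset (msupp f)) -(mem_sort deglex) /lt_mon.
rewrite -nth_last mem_nth // size_sort prednK //.
by rewrite -cardfE in nz.
Qed.

Lemma lt_mon_max f u : u \in msupp f -> deglex u (lt_mon f).
Proof.
rewrite -[_ \in _]/(_ \in enum_fset (msupp f)) -(mem_sort deglex) /lt_mon.
have := sort_sorted deglex_total (enum_fset (msupp f)).
move: (sort _ _) => s; case/lastP: s => // s v; rewrite last_rcons.
rewrite (sorted_pairwise deglex_trans) pairwise_rcons => /andP[/allP le_v _].
rewrite mem_rcons inE => /orP[/eqP->|/le_v //].
by have := deglex_total v v; rewrite orbb.
Qed.

Definition is_groebner (J G : A -> Prop) : Prop :=
  (forall g, G g -> J g) /\
  (forall f, J f -> f != 0 ->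
     exists g, [/\ G g, g != 0
                 & infix (fmonom_val (lt_mon g)) (fmonom_val (lt_mon f))]).

Inductive basis : A -> Prop :=
| basis_f' i j of (j < i)%O :
    basis (bracket (bracket (x_ i) (x_ j)) (x_ j))
| basis_f'' i j of (j < i)%O :
    basis (bracket (x_ i) (bracket (x_ i) (x_ j)))
| basis_g' i j k of (k < j)%O & (j < i)%O :
    basis (bracket (x_ i) (bracket (x_ j) (x_ k)))
| basis_g'' i j k of (k < j)%O & (j < i)%O :
    basis (bracket (bracket (x_ i) (x_ k)) (x_ j))
| basis_h i j k of (k < j)%O & (j < i)%O :
    basis (bracket (bracket (x_ i) (x_ j)) (bracket (x_ i) (x_ k))).

End FreeAlgebra.

(* Main.v *)
From HB Require Import structures.
Require Import Defs.
From mathcomp Require Import all_boot all_order all_algebra.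
From mathcomp Require Import finmap monalg.

Set Implicit Arguments.
Unset Strict Implicit.
Unset Printing Implicit Defensive.

Import Order.TTheory GRing.Theory.
Local Open Scope ring_scope.
Local Notation "x * y" := (mmul x y) : monom_scope.

(** Modulo the ideal generated by [gamma3] a commutator of two letters becomes
    central, so the quotient of the free algebra is the enveloping algebra of
    the free nilpotent Lie algebra of class two.  It acts on commutative
    polynomials in variables [t_a] (a letter) and [y_ab] (a pair of letters
    [b < a]) by the Heisenberg operators
      [X_a = t_a + sum over b < a of y_ab d/dt_b],
    because [X_a X_b - X_b X_a] is multiplication by [y_ab] for [b < a] and
    multiplication by a [y] commutes with every [X_c].  Applying a word [u] to
    [1] gives a polynomial [word_poly u], and this extends to a linear map on
    the free algebra which vanishes on the ideal ([act_ideal_gamma3]).  No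
    division occurs, so the characteristic is irrelevant.

    Call a word normal when it contains none of the leading monomials of the
    announced basis.  A normal word splits uniquely into blocks, which are
    descents [ab] with [b < a] and single letters; replacing a block [ab] by
    [y_ab] and a single letter [a] by [t_a] gives a commutative monomial
    [mon w].  A monomial can occur in [word_poly u] only if its variables
    [y_ab] can be matched with disjoint inversions of [u], the unmatched
    letters giving the [t_a]; if it is [mon w], then [u] is a shuffle of the
    blocks of [w].  The lexicographically least shuffle of the blocks of a
    normal word [w] is [w] itself: greedily, one picks the least first letter
    [a] available, then, as long as there are blocks [ab] left, the least such
    [b], which is smaller than all the other first letters.  Hence [mon w]
    occurs in [word_poly w] with coefficient 1 ([mcoeff_mon]) and in
    [word_poly u] only if [w <= u] ([word_poly_ge]).

    If [f] is a nonzero element of the ideal and its leading monomial [w] were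
    normal, then the coefficient of [mon w] in the image of [f], which is zero,
    would be the leading coefficient of [f].  So [w] is not normal
    ([ideal_lt_not_normal]), that is, it contains the leading monomial of an
    element of the basis ([not_normal_basis]).  Those leading monomials come
    from one remark: for monic [f] and [g] with leading monomials [w] and [v]
    such that [vw < wv], the bracket of [f] and [g] is monic with leading
    monomial [wv] ([monic_lt_bracket]). *)

(** * Partial derivatives of commutative polynomials *)

Section Derivation.

Context {K : fieldType} {V : choiceType}.
Local Notation P := {malg K[{cmonom V}]}.
Implicit Types (p q : P) (v w : V) (m : {cmonom V}).

Definition pvar v : P := << ucm v >>.

Definition pderiv v : P -> P :=
  mmap (@malgC _ K) (fun m => << (m v)%:R *g divcm m (ucm v) >>).

Fact pderiv_is_additive v : additive (pderiv v).
Proof. exact: mmap_is_additive. Qed.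

HB.instance Definition _ v :=
  GRing.isAdditive.Build P P (pderiv v) (pderiv_is_additive v).

Lemma mcoeff_pvarM v p m : (pvar v * p)@_(ucm v * m)%M = p@_m.
Proof.
rewrite [p]monalgE mulr_sumr !raddf_sum; apply: eq_bigr => n _ /=.
rewrite malgM_def fgmulUU mul1r !mcoeffU; congr (_ *+ _).
by apply: congr1; apply/eqP/eqP=> [|->//] /eqP/cmP e; apply/eqP/cmP=> i;
   have := e i; rewrite !cmM => /addnI.
Qed.

Lemma mulm_divcm v m : m v != 0%N -> m = (ucm v * divcm m (ucm v))%M.
Proof.
move=> nz; apply/eqP/cmP=> i; rewrite cmM divcmE cmU subnKC //.
by case: eqP => // <-; rewrite lt0n.
Qed.

Lemma divcmK v m : divcm (ucm v * m)%M (ucm v) = m.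
Proof. by apply/eqP/cmP=> i; rewrite divcmE cmM addKn. Qed.

Lemma ucmI v m n : (ucm v * m)%M = (ucm v * n)%M -> m = n.
Proof. by move=> /(congr1 (fun m => divcm m (ucm v))); rewrite !divcmK. Qed.

Lemma mcoeff_pvarM0 v p m : m v = 0%N -> (pvar v * p)@_m = 0.
Proof.
move=> m0; rewrite [p]monalgE mulr_sumr !raddf_sum big1 // => n _ /=.
rewrite malgM_def fgmulUU mul1r !mcoeffU; case: eqP => // /eqP/cmP/(_ v).
by rewrite cmM cmUU m0.
Qed.

Lemma pderivU v c m :
  pderiv v << c *g m >> = << c * (m v)%:R *g divcm m (ucm v) >>.
Proof. by rewrite /pderiv mmapU /= malgM_def fgmulUU mul1m. Qed.

Lemma mcoeff_pderiv v p m :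
  (pderiv v p)@_m = (m v).+1%:R * p@_(ucm v * m)%M.
Proof.
rewrite [p]monalgE (raddf_sum (pderiv v)) !(raddf_sum (mcoeff _)) mulr_sumr.
apply: eq_bigr => n _ /=.
rewrite pderivU !mcoeffU; have [e|ne] := boolP (n v == 0%N).
  rewrite (eqP e) mulr0 mul0rn; case: eqP => [en|_]; last by rewrite mulr0.
  by move: e; rewrite en cmM cmUU.
rewrite (mulm_divcm ne) divcmK; case: eqP => [->|nm].
  by rewrite eqxx cmM cmUU mulr1n mulrC.
by case: eqP => [/ucmI//|_]; rewrite mulr0.
Qed.

Lemma pderiv_comm v w p : pderiv v (pderiv w p) = pderiv w (pderiv v p).
Proof.
apply/malgP=> m.
rewrite [in LHS]mcoeff_pderiv.
rewrite [in LHS]mcoeff_pderiv.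
rewrite [in RHS]mcoeff_pderiv.
rewrite [in RHS]mcoeff_pderiv.
rewrite [in RHS]mulmA [(ucm v * ucm w)%M]mulmC -mulmA !mulrA; congr (_ * _).
rewrite !cmM !cmU [w == v]eq_sym; case: eqP => [->//|_].
by rewrite !add0n mulrC.
Qed.

Lemma pderiv_pvarM v w p :
  pderiv v (pvar w * p) = pvar w * pderiv v p + p *+ (v == w).
Proof.
apply/malgP=> m; rewrite mcoeff_pderiv mcoeffD mcoeffMn.
have [e|ne] := boolP (m w == 0%N).
  rewrite (mcoeff_pvarM0 _ (eqP e)) add0r; case: (eqVneq v w) => [->|vw].
    by rewrite mcoeff_pvarM (eqP e) mul1r.
  by rewrite mcoeff_pvarM0 ?mulr0 // cmM cmU (eqP e) (negPf vw).
rewrite (mulm_divcm ne) mulmA [(ucm v * _)%M]mulmC -mulmA !mcoeff_pvarM.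
rewrite [in RHS]mcoeff_pderiv !cmM !cmU [w == v]eq_sym; case: eqP => [->|_].
  by rewrite add1n [in LHS]mulrS mulrDl mul1r addrC.
by rewrite mulr0n addr0.
Qed.

Lemma pderivZ v c p : pderiv v (c *: p) = c *: pderiv v p.
Proof.
apply/malgP=> m; rewrite (mcoeff_pderiv v (c *: p)) !mcoeffZ.
by rewrite (mcoeff_pderiv v p) mulrCA.
Qed.

End Derivation.

(** * Ideals containing the third term of the lower central series *)

Lemma commutator_jacobi (R : nzRingType) (f g h : R) :
  f * (g * h - h * g) - (g * h - h * g) * f =
  (f * g - g * f) * h - h * (f * g - g * f) +
  (g * (f * h - h * f) - (f * h - h * f) * g).
Proof.
rewrite !mulrBr !mulrBl !mulrA.
move: (f * g * h) (f * h * g) (g * h * f) (h * g * f) (g * f * h) (h * f * g).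
move=> x y z t a b; rewrite !opprB !addrA.
by rewrite [RHS](ACl (1*8*3*6*(5*2)*(7*4))%AC) /= !subrr !addr0.
Qed.

Section Lie.
Context {K : fieldType} {d : Order.disp_t} {I : orderType d}.
Local Notation A := {malg K[{fmonom I}]}.
Implicit Types f g h : A.

Lemma malg_scalerAr c f g : f * (c *: g) = c *: (f * g).
Proof.
apply/malgP=> u; rewrite [in RHS]mcoeffZ [in RHS]mcoeffMl.
rewrite (mcoeffMlw _ (fsubset_refl _) (msuppZ_le c g)) mulr_sumr.
apply: eq_bigr => v _; rewrite mulr_sumr; apply: eq_bigr => w _.
by rewrite mcoeffZ mulrCA mulrnAr.
Qed.

Lemma bracketC f g : bracket f g = - bracket g f.
Proof. by rewrite /bracket opprB. Qed.

Lemma bracketDl f g h : bracket (f + g) h = bracket f h + bracket g h.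
Proof. by rewrite /bracket mulrDl mulrDr opprD addrACA. Qed.

Lemma bracketZl c f h : bracket (c *: f) h = c *: bracket f h.
Proof. by rewrite /bracket malg_scalerAr -scalerAl scalerBr. Qed.

Lemma jacobi f g h :
  bracket f (bracket g h) = bracket (bracket f g) h + bracket g (bracket f h).
Proof.
exact: commutator_jacobi.
Qed.

Variable J : A -> Prop.
Hypotheses (J0 : J 0) (JD : forall f g, J f -> J g -> J (f + g)).
Hypothesis JZ : forall c f, J f -> J (c *: f).
Hypotheses (JMl : forall f g, J g -> J (f * g))
           (JMr : forall f g, J f -> J (f * g)).
Hypothesis Jx : forall a b c, J (bracket (bracket (x_ a) (x_ b)) (x_ c)).

Let JN f : J f -> J (- f).
Proof. by rewrite -scaleN1r; apply: JZ. Qed.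

Let J_bracketl f g : J f -> J (bracket f g).
Proof. by move=> Jf; apply: JD; [apply: JMr|apply/JN/JMl]. Qed.

Let J_bracketr f g : J g -> J (bracket f g).
Proof. by move=> Jg; apply: JD; [apply: JMl|apply/JN/JMr]. Qed.

Let bracket0l f : bracket 0 f = 0.
Proof. by rewrite /bracket mul0r mulr0 subrr. Qed.

Let bracket0r f : bracket f 0 = 0.
Proof. by rewrite /bracket mul0r mulr0 subrr. Qed.

Let bracketDr f g h : bracket f (g + h) = bracket f g + bracket f h.
Proof. by rewrite /bracket mulrDl mulrDr opprD addrACA. Qed.

Let bracketZr c f h : bracket f (c *: h) = c *: bracket f h.
Proof. by rewrite /bracket malg_scalerAr -scalerAl scalerBr. Qed.

Let central f := forall g, freeLie g -> J (bracket f g).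

Let central_id f : J f -> central f.
Proof. by move=> Jf g _; apply: J_bracketl. Qed.

(** By the Jacobi identity the elements commuting with [f] modulo [J] form a
    Lie subalgebra, so it is enough to test the letters. *)
Let central_gen f : (forall a, J (bracket f (x_ a))) -> central f.
Proof.
move=> Jf g; elim: g / => [a||g h _ IHg _ IHh|c g _ IHg|g h _ IHg _ IHh].
- exact: Jf.
- by rewrite bracket0r.
- by rewrite bracketDr; apply: JD; [exact: IHg|exact: IHh].
- by rewrite bracketZr; apply: JZ; exact: IHg.
- rewrite jacobi; apply: JD.
    by apply: J_bracketl; exact: IHg.
  by apply: J_bracketr; exact: IHh.
Qed.

(** When [g] is itself a bracket, the Jacobi identity writes [bracket f g] as a
    sum of two brackets with a central argument, so it even lies in [J]. *)
Let central_genr f g : freeLie g -> (forall a, central (bracket f (x_ a))) ->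
  central (bracket f g).
Proof.
move=> Lg Cf; elim: g / Lg => [a||g h _ IHg _ IHh|c g _ IHg|g h Lg IHg Lh IHh].
- exact: Cf.
- by rewrite bracket0r; apply: central_id.
- move=> k Lk; rewrite bracketDr bracketDl.
  by apply: JD; [exact: IHg|exact: IHh].
- by move=> k Lk; rewrite bracketZr bracketZl; apply: JZ; exact: IHg.
- apply: central_id; rewrite jacobi; apply: JD; first exact: IHg.
  by rewrite bracketC; apply: JN; exact: IHh.
Qed.

(** Modulo [J] the free Lie algebra is nilpotent of class two. *)
Lemma bracket_central f g : freeLie f -> freeLie g -> central (bracket f g).
Proof.
move=> Lf; elim: f / Lf g => [a|||c f _ IHf|].
- by move=> g Lg; apply: central_genr => // b; apply: central_gen.
- by move=> g _; rewrite bracket0l; apply: central_id.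
- move=> f h _ IHf _ IHh g Lg k Lk; rewrite 2!bracketDl.
  by apply: JD; [exact: IHf|exact: IHh].
- by move=> g Lg k Lk; rewrite 2!bracketZl; apply: JZ; exact: IHf.
move=> f h Lf IHf Lh IHh g Lg; apply: central_id.
rewrite bracketC jacobi; apply: JN; apply: JD.
  by rewrite [bracket g f]bracketC -scaleN1r bracketZl; apply: JZ; exact: IHf.
by rewrite bracketC [bracket g h]bracketC -2!scaleN1r bracketZl;
   do 2 apply: JZ; exact: IHh.
Qed.

Lemma gamma3_sub f : gamma3 f -> J f.
Proof.
elim: f / => [_ [f [h [Lf Lh ->]]]||f g _ Jf _ Jg|c f _ Jf].
- elim: f / Lf => [_ [f [g [Lf Lg ->]]]||f g _ Jf _ Jg|c f _ Jf].
  + exact: bracket_central.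
  + by rewrite bracket0l.
  + by rewrite bracketDl; apply: JD; [exact: Jf|exact: Jg].
  + by rewrite bracketZl; apply: JZ; exact: Jf.
- exact: J0.
- by apply: JD; [exact: Jf|exact: Jg].
- by apply: JZ; exact: Jf.
Qed.

Lemma ideal_gamma3_sub f : ideal_gen gamma3 f -> J f.
Proof.
elim: f / => [_ [a [f [b [Gf ->]]]]||f g _ Jf _ Jg|c f _ Jf].
- by apply: JMr; apply: JMl; exact: gamma3_sub.
- exact: J0.
- by apply: JD; [exact: Jf|exact: Jg].
- by apply: JZ; exact: Jf.
Qed.
End Lie.

(** * Heisenberg operators *)

Section Op.
Context {K : nzRingType} {P : comAlgType K}.
Context {d : Order.disp_t} {I : orderType d}.
Variables (below : I -> seq I) (t : I -> P) (y : I -> I -> P).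
Variable (D : I -> {additive P -> P}).
Hypothesis below_uniq : forall a, uniq (below a).
Hypothesis mem_below : forall a b, (b \in below a) = (b < a)%O.
Hypothesis D_comm : forall a b p, D a (D b p) = D b (D a p).
Hypothesis D_t : forall a b p, D a (t b * p) = t b * D a p + p *+ (a == b).
Hypothesis D_y : forall a b c p, D a (y b c * p) = y b c * D a p.
Hypothesis D_scale : forall a (k : K) p, D a (k *: p) = k *: D a p.

Implicit Types (p q : P) (a b c : I).

(** Only the commutation rules of the multiplications [t], [y] and of the
    derivations [D] matter, so the operators are studied over an arbitrary
    commutative algebra.  The finite list [below a] makes sense of the sum over
    all [b < a]. *)
Definition heis_op a p : P := t a * p + \sum_(b <- below a) y a b * D b p.

Lemma heis_opD a p q : heis_op a (p + q) = heis_op a p + heis_op a q.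
Proof.
rewrite /heis_op mulrDr addrACA -big_split; congr (_ + _).
by apply: eq_bigr => b _; rewrite raddfD mulrDr.
Qed.

Lemma heis_opZ a (k : K) p : heis_op a (k *: p) = k *: heis_op a p.
Proof.
rewrite /heis_op -scalerAr scalerDr scaler_sumr; congr (_ + _).
by apply: eq_bigr => b _; rewrite D_scale -scalerAr.
Qed.

Lemma heis_op_y a b c p : heis_op a (y b c * p) = y b c * heis_op a p.
Proof.
rewrite /heis_op mulrDr mulrCA mulr_sumr; congr (_ + _).
by apply: eq_bigr => e _; rewrite D_y mulrCA.
Qed.

(** Up to its last summand, which comes from [D b] meeting [t b], the result
    is symmetric in [a] and [b]. *)
Lemma heis_op2 a b p : heis_op a (heis_op b p) =
  t a * (t b * p)
  + (\sum_(e <- below b) y b e * (t a * D e p)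
     + \sum_(c <- below a) y a c * (t b * D c p))
  + \sum_(c <- below a) \sum_(e <- below b)
      y a c * (y b e * D c (D e p))
  + (if (b < a)%O then y a b * p else 0).
Proof.
have E : (if (b < a)%O then y a b * p else 0) =
         \sum_(c <- below a) y a c * (p *+ (c == b)).
  rewrite -mem_below; case: ifP => [ba|bna].
    rewrite (bigD1_seq b) //= eqxx big1 ?addr0 // => c /negPf->.
    exact: mulr0.
  rewrite big_seq big1 // => c ca; case: eqP => [e|_]; last by rewrite mulr0.
  by rewrite -e ca in bna.
rewrite {}E [heis_op a _]/heis_op {1}/heis_op mulrDr mulr_sumr -!addrA.
congr (_ + _).
congr (_ + _); first by apply: eq_bigr => e _; rewrite mulrCA.
rewrite -!big_split; apply: eq_bigr => c _.
rewrite /heis_op raddfD D_t raddf_sum !mulrDr -!addrA; congr (_ + _).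
rewrite addrC mulr_sumr; congr (_ + _).
by apply: eq_bigr => e _; rewrite D_y.
Qed.

Lemma heis_op_comm a b p : heis_op a (heis_op b p) - heis_op b (heis_op a p) =
  (if (b < a)%O then y a b * p else 0)
  - (if (a < b)%O then y b a * p else 0).
Proof.
rewrite heis_op2 (heis_op2 b a).
set S := (X in X + _ - _); set S' := (X in _ - (X + _)).
suff -> : S = S' by rewrite [S' + _]addrC addrKA.
rewrite {}/S {}/S'; congr (_ + _ + _).
- by rewrite mulrCA.
- by rewrite addrC.
- rewrite exchange_big; apply: eq_bigr => c _; apply: eq_bigr => e _.
  by rewrite mulrCA D_comm.
Qed.

(** The commutator of [X_a] and [X_b] is multiplication by [y a b], by
    [- y b a] or by [0], and these multiplications commute with [X_c]. *)
Lemma heis_op_nilpotent a b c p :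
  heis_op a (heis_op b (heis_op c p)) - heis_op b (heis_op a (heis_op c p)) =
  heis_op c (heis_op a (heis_op b p) - heis_op b (heis_op a p)).
Proof.
have op0 e : heis_op e 0 = 0.
  by apply: (addrI (heis_op e 0)); rewrite -heis_opD !addr0.
have opN e q : heis_op e (- q) = - heis_op e q.
  by apply/eqP; rewrite -addr_eq0 -heis_opD addNr op0.
by rewrite !heis_op_comm heis_opD opN; do 2!case: ifP; rewrite ?op0 ?heis_op_y.
Qed.
End Op.

(** * Modules over the free algebra *)

Section Act.
Context {K : fieldType} {d : Order.disp_t} {I : orderType d} {M : lmodType K}.
Local Notation A := {malg K[{fmonom I}]}.
Variable T : I -> M -> M.
Hypothesis TD : forall a p q, T a (p + q) = T a p + T a q.
Hypothesis TZ : forall a (k : K) p, T a (k *: p) = k *: T a p.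
Implicit Types (f g : A) (p q : M) (a b c : I) (u w : seq I).

Definition actw u p : M := foldr T p u.

Definition act p f : M := \sum_(u <- msupp f) f@_u *: actw u p.

Lemma actEw (s : {fset {fmonom I}}) p f : (msupp f `<=` s)%fset ->
  act p f = \sum_(u <- s) f@_u *: actw u p.
Proof.
move=> le; rewrite /act (big_fset_incl _ le) // => x _ /mcoeff_outdom ->.
exact: scale0r.
Qed.

Lemma act_is_additive p : additive (act p).
Proof.
move=> f g.
rewrite (actEw (s := (msupp f `|` msupp g)%fset) _ (msuppB_le f g)).
rewrite (actEw _ (fsubsetUl (msupp f) (msupp g))).
rewrite (actEw _ (fsubsetUr (msupp f) (msupp g))) -sumrB.
by apply: eq_bigr => u _; rewrite mcoeffB scalerBl.
Qed.

HB.instance Definition _ p := GRing.isAdditive.Build A M (act p)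
  (act_is_additive p).

Lemma actU p (k : K) (u : {fmonom I}) : act p << k *g u >> = k *: actw u p.
Proof. by rewrite (actEw _ msuppU_le) big_seq_fset1 mcoeffUU. Qed.

Lemma actD p f g : act p (f + g) = act p f + act p g.
Proof. exact: raddfD. Qed.

Lemma actZ p (k : K) f : act p (k *: f) = k *: act p f.
Proof.
rewrite (actEw _ (msuppZ_le k f)) scaler_sumr; apply: eq_bigr => u _.
by rewrite mcoeffZ scalerA.
Qed.

Lemma actwD u p q : actw u (p + q) = actw u p + actw u q.
Proof. by elim: u => //= a u ->. Qed.

Lemma actwZ u (k : K) p : actw u (k *: p) = k *: actw u p.
Proof. by elim: u => //= a u ->. Qed.

Lemma actw_sum (J : Type) (s : seq J) (F : J -> M) u :
  actw u (\sum_(j <- s) F j) = \sum_(j <- s) actw u (F j).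
Proof.
have aw0 : actw u 0 = 0 by rewrite -(scale0r (0 : M)) actwZ !scale0r.
by apply: (big_morph _ (actwD u)).
Qed.

Lemma actM p f g : act p (f * g) = act (act p g) f.
Proof.
rewrite malgME (raddf_sum (act p)); apply: eq_bigr => u _.
rewrite (raddf_sum (act p)) [act p g]/act actw_sum scaler_sumr.
apply: eq_bigr => v _; rewrite /= actU actwZ scalerA; congr (_ *: _).
by rewrite /actw fmM foldr_cat.
Qed.

Lemma act_x p a : act p (x_ a) = T a p.
Proof. by rewrite actU scale1r /actw fmU. Qed.

Lemma act_bracket p f g :
  act p (bracket f g) = act (act p g) f - act (act p f) g.
Proof. by rewrite [LHS](raddfB (act p)); congr (_ - _); exact: actM. Qed.

Hypothesis T_nil : forall a b c p,
  T a (T b (T c p)) - T b (T a (T c p)) = T c (T a (T b p) - T b (T a p)).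

(** The annihilator of the module is a two-sided ideal; it contains the triple
    commutators of letters by [T_nil]. *)
Lemma act_ideal_gamma3 p f : ideal_gen gamma3 f -> act p f = 0.
Proof.
move=> If; move: f If p.
apply: (ideal_gamma3_sub (J := fun f => forall p, act p f = 0)).
- by move=> p; exact: raddf0.
- by move=> f g f0 g0 p; rewrite actD f0 g0 addr0.
- by move=> c f f0 p; rewrite actZ f0 scaler0.
- move=> f g g0 p; rewrite actM g0 /act big1 // => u _.
  by rewrite -(scale0r (0 : M)) actwZ !scale0r scaler0.
- by move=> f g f0 p; rewrite actM f0.
move=> a b c p.
have Exx q : act q (bracket (x_ a) (x_ b)) = T a (T b q) - T b (T a q).
  by rewrite act_bracket (act_x q a) (act_x q b) act_x act_x.
rewrite act_bracket (Exx p) (act_x p c) (Exx (T c p)) act_x T_nil.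
exact: subrr.
Qed.
End Act.

(** * Normal words *)

Section Normal.
Context {d : Order.disp_t} {I : orderType d}.
Implicit Types (a b c e : I) (u w s : seq I).
Local Notation V := (I + I * I)%type.

(** For [b <= a] and [c < a] the prefix [abc] is the leading monomial of one
    of the brackets of length three: of [f''] for [b = a], and for [b < a] of
    [f'], [g'] or [g''] according to whether [c = b], [c < b] or [b < c].  The
    test on the fourth letter [e] is for the family [h]. *)
Definition ok_head w : bool :=
  match w with
  | a :: b :: c :: s =>
      ~~ ((b <= a)%O && (c < a)%O) &&
      (if s is e :: _ then ~~ [&& (b < a)%O, c == a & (e < b)%O] else true)
  | _ => true
  end.

Fixpoint normal w : bool :=
  if w is _ :: w' then ok_head w && normal w' else true.

(** The nested match reads the word block by block: a descent is consumed whole,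
    and a letter that does not start a descent is consumed alone. *)
Fixpoint mon w : {cmonom V} :=
  match w with
  | [::] => mone
  | a :: w' =>
    match w' with
    | b :: s =>
        if (b < a)%O then (ucm (inr (a, b)) * mon s)%M
        else (ucm (inl a) * mon w')%M
    | [::] => ucm (inl a)
    end
  end.

(** The first letter of the block that a variable stands for. *)
Definition leader (v : V) : I :=
  match v with inl a => a | inr (a, _) => a end.

Lemma mon_pair a b s : (b < a)%O ->
  mon (a :: b :: s) = (ucm (inr (a, b)) * mon s)%M.
Proof. by move=> /= ->. Qed.

Definition descent w : bool := if w is a :: b :: _ then (b < a)%O else false.

Lemma mon_single a s : ~~ descent (a :: s) ->
  mon (a :: s) = (ucm (inl a) * mon s)%M.
Proof. by case: s => [_|b s /negPf /= -> //]; rewrite /= mulm1. Qed.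

(** Induction over the blocks of a normal word. *)
Lemma normal_ind (Q : seq I -> Prop) :
  Q [::] ->
  (forall a s, normal (a :: s) -> ~~ descent (a :: s) -> Q s -> Q (a :: s)) ->
  (forall a b s, normal (a :: b :: s) -> (b < a)%O -> Q s -> Q (a :: b :: s)) ->
  forall w, normal w -> Q w.
Proof.
move=> Q0 Q1 Q2 w; have [n] := ubnP (size w).
elim: n w => // n IHn [//|a s] /= le_n /andP[ok_a ns].
have nas : normal (a :: s) by rewrite /= ok_a.
have [|nd] := boolP (descent (a :: s)); last by apply: Q1 => //; apply: IHn.
case: s {ok_a} le_n ns nas => // b s le_n /= /andP[_ ns] nas ba.
by apply: Q2 => //; apply: IHn => //; apply: ltnW.
Qed.

(** In a normal word the first letters of the blocks increase weakly. *)
Lemma leader_ge w a : normal w -> (a <= head a w)%O ->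
  forall v, mon w v != 0%N -> (a <= leader v)%O.
Proof.
move=> nw; elim/normal_ind: w / nw a =>
  [a _ v|a s n1 nd IHs c ca v|a b s n1 ba IHs c ca v].
- by rewrite /= cm1.
- rewrite mon_single // cmM cmU addn_eq0 negb_and eqb0 negbK.
  case/orP=> [/eqP<-//|].
  move=> /(IHs a) h; apply: le_trans ca (h _).
  by case: s nd {n1 IHs h} => //= b s; rewrite -leNgt.
- rewrite mon_pair // cmM cmU addn_eq0 negb_and eqb0 negbK.
  case/orP=> [/eqP<-//|].
  move=> /(IHs a) h; apply: le_trans ca (h _).
  case: s n1 {IHs h} => //= e s.
  by rewrite (ltW ba) /= -leNgt => /andP[/andP[]].
Qed.

Lemma leader_mon a s v : normal (a :: s) -> mon (a :: s) v != 0%N ->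
  (a <= leader v)%O.
Proof. by move=> n; apply: leader_ge. Qed.

Lemma leader_mon_tail a b s v : normal (a :: b :: s) -> (b < a)%O ->
  mon s v != 0%N -> (a <= leader v)%O.
Proof.
move=> n ba nz; apply: leader_mon n _.
by rewrite mon_pair // cmM addn_eq0 negb_and nz orbT.
Qed.

(** Among the blocks with the least first letter [a], the descents precede the
    single letters, since [a a e] with [e < a] is excluded, and their second
    letters increase weakly, since [a b a e] with [e < b < a] is excluded.  The
    bound [a <= head a w] also covers the empty word. *)
Lemma mon_descent_ge w : normal w -> forall a e,
  (a <= head a w)%O -> mon w (inr (a, e)) != 0%N ->
  descent w /\ (head a (behead w) <= e)%O.
Proof.
move=> nw; elim/normal_ind: w / nw =>
  [a e _|a s n1 nd IHs c e ca|a b s n1 ba IHs c e ca].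
- by rewrite /= cm1.
- rewrite mon_single // cmM cmU add0n => nz.
  have ns : normal s by case/andP: n1.
  case: s ca n1 nd IHs ns nz => [|b s] /= ca n1 nd IHs ns nz.
    by rewrite cm1 in nz.
  have ba : (a <= b)%O by rewrite leNgt.
  have [] := IHs c e _ nz; first exact: le_trans ca ba.
  have := leader_mon ns nz => /= bc.
  have {ca ba bc} [eab ebc]: a = b /\ c = b.
    have cb : c = b by apply: le_anti; rewrite bc (le_trans ca ba).
    by split=> //; apply: le_anti; rewrite ba -cb ca.
  subst; case: s n1 {nd IHs ns nz} => //= e' s.
  by rewrite lexx /= => /andP[/andP[/negPf->]].
- move=> nz; split; first by [].
  rewrite /=; move: nz.
  rewrite mon_pair // cmM cmU addn_eq0 negb_and eqb0 negbK.
  case/orP=> [/eqP[_ ->]//|nz].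
  have ac := leader_mon_tail n1 ba nz; rewrite /= in ac.
  have {ca ac} ec : c = a by apply: le_anti; rewrite ca ac.
  subst c; case: s n1 IHs nz => [_ _|c s n1 IHs nz]; first by rewrite cm1.
  have ac : (a <= c)%O.
    by move: n1; rewrite /= (ltW ba) /= -leNgt => /andP[/andP[]].
  have ns : normal (c :: s) by case/and3P: n1.
  have [] := IHs a e ac nz; have := leader_mon ns nz => /= ca.
  have {ca ac}ec : c = a by apply: le_anti; rewrite ca ac.
  subst c; case: s n1 {IHs nz ns} => //= f s.
  rewrite ba eqxx /= -leNgt => /andP[/andP[_ bf] _] _; exact: le_trans.
Qed.

Lemma mon_single0 a s e : normal (a :: s) -> ~~ descent (a :: s) ->
  mon (a :: s) (inr (a, e)) = 0%N.
Proof.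
move=> n nd; apply/eqP; apply: contraNT nd => nz.
by have [] := mon_descent_ge n (lexx a) nz.
Qed.

Lemma mon_pair_ge a b s e : normal (a :: b :: s) ->
  mon (a :: b :: s) (inr (a, e)) != 0%N -> (b <= e)%O.
Proof. by move=> n /(mon_descent_ge n (lexx a)) []. Qed.

End Normal.

(** * The polynomial of a word *)

Section Rep.
Context {K : fieldType} {d : Order.disp_t} {I : orderType d}.
Variable below : I -> seq I.
Hypothesis below_uniq : forall a, uniq (below a).
Hypothesis mem_below : forall a b, (b \in below a) = (b < a)%O.

Local Notation A := {malg K[{fmonom I}]}.
Local Notation V := (I + I * I)%type.
Local Notation P := {malg K[{cmonom V}]}.
Implicit Types (f g : A) (p q : P) (a b c e : I) (u w s : seq I).
Implicit Types (m n : {cmonom V}) (v : V).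

Definition heis a : P -> P :=
  heis_op below (fun a => pvar (inl a)) (fun a b => pvar (inr (a, b)))
    (fun a => pderiv (inl a)) a.

(** The coefficient of [m] in the product of the variable [v] with a polynomial
    whose coefficients are given by [F] (see [mcoeff_pvarM_pull]). *)
Definition pull (F : {cmonom V} -> K) v m : K :=
  if m v == 0%N then 0 else F (divcm m (ucm v)).

Lemma pull0 F v m : m v = 0%N -> pull F v m = 0.
Proof. by rewrite /pull => ->. Qed.

Lemma pullM F v m : pull F v (ucm v * m)%M = F m.
Proof. by rewrite /pull cmM cmUU divcmK. Qed.

Lemma pull_neq0 F v m : pull F v m != 0 ->
  exists2 n, m = (ucm v * n)%M & F n != 0.
Proof.
rewrite /pull; have [_|nz Fn0] := eqVneq (m v) 0%N; first by rewrite eqxx.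
by exists (divcm m (ucm v)); first exact: mulm_divcm.
Qed.

Lemma mcoeff_pvarM_pull v p m : (pvar v * p)@_m = pull (mcoeff^~ p) v m.
Proof.
rewrite /pull; have [m0|nz] := eqVneq (m v) 0%N; first exact: mcoeff_pvarM0.
by rewrite {1}(mulm_divcm nz); exact: mcoeff_pvarM.
Qed.

Lemma mcoeff_heis a p m : (heis a p)@_m =
  pull (mcoeff^~ p) (inl a) m +
  \sum_(b <- below a)
    pull (fun n => (n (inl b)).+1%:R * p@_(ucm (inl b) * n)%M) (inr (a, b)) m.
Proof.
rewrite -mcoeff_pvarM_pull /heis /heis_op [LHS]mcoeffD; congr (_ + _).
rewrite [LHS](raddf_sum (mcoeff m)); apply: eq_bigr => b _.
rewrite [LHS]mcoeff_pvarM_pull /pull; case: ifP => // _.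
exact: mcoeff_pderiv.
Qed.

(** Reading a letter [a] either uses up a variable [t_a], or matches [a] with a
    smaller letter [b] still to come: it uses up [y_ab] and demands a [t_b]. *)
Lemma mcoeff_heis_neq0 a p m : (heis a p)@_m != 0 ->
  (exists2 n, m = (ucm (inl a) * n)%M & p@_n != 0) \/
  (exists b n, [/\ (b < a)%O, m = (ucm (inr (a, b)) * n)%M
                & p@_(ucm (inl b) * n)%M != 0]).
Proof.
rewrite mcoeff_heis; set x := pull _ _ _; set F := BIG_F => nz.
have [x0|/pull_neq0] := eqVneq x 0; last by left.
right.
have [/hasP[b ba]|/hasPn F0] := boolP (has (fun b => F b != 0) (below a)).
  case/pull_neq0=> n -> nz'; exists b, n; split; rewrite -?mem_below //.
  by apply: contraNneq nz' => ->; rewrite mulr0.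
case/negP: nz; rewrite x0 add0r big_seq big1 // => b /F0.
by rewrite negbK => /eqP.
Qed.

Lemma mcoeff_heis_leader a p m : (heis a p)@_m != 0 ->
  exists2 v, m v != 0%N & leader v = a.
Proof.
case/mcoeff_heis_neq0=> [[n -> _]|[b [n [_ -> _]]]].
  by exists (inl a); rewrite // cmM cmUU.
by exists (inr (a, b)); rewrite // cmM cmUU.
Qed.

Lemma mcoeff_heis_single a p m : (forall e, m (inr (a, e)) = 0%N) ->
  (heis a p)@_(ucm (inl a) * m)%M = p@_m.
Proof.
move=> m0; rewrite mcoeff_heis pullM big1 ?addr0 // => e _.
by rewrite pull0 // cmM cmU m0.
Qed.

(** After reading [a] and then [b < a], a monomial whose other leaders are at
    least [a] has used up [y_ab]: any other way of reading [a] leaves no variable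
    with leader [b] for reading [b]. *)
Lemma mcoeff_heis_pair a b q m : (b < a)%O ->
  (forall v, m v != 0%N -> (a <= leader v)%O) ->
  (heis a (heis b q))@_(ucm (inr (a, b)) * m)%M = q@_m.
Proof.
move=> ba mge.
have m0 v : leader v = b -> m v = 0%N.
  by move=> vb; apply/eqP; apply: contraTT ba => /mge; rewrite vb -leNgt.
(* Reading [b] needs a variable with leader [b]. *)
have coef0 n : (forall v, leader v = b -> n v = 0%N) -> (heis b q)@_n = 0.
  move=> n0; apply/eqP; apply: contraT => /mcoeff_heis_leader[v nv /n0 e].
  by rewrite e in nv.
have coefb : (heis b q)@_(ucm (inl b) * m)%M = q@_m.
  by apply: mcoeff_heis_single => e; apply: m0.
have nba : (a == b) = false by rewrite eq_sym lt_eqF.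
move: (heis b q) coef0 coefb => p coef0 coefb.
rewrite mcoeff_heis (bigD1_seq b) ?mem_below ?below_uniq //= pullM.
rewrite m0 // mul1r coefb.
set m' := (ucm (inr (a, b)) * m)%M.
have m'0 v v0 : leader v = b -> divcm m' (ucm v0) v = 0%N.
  move=> vb; rewrite divcmE cmM !cmU m0 // addn0; case: v vb => [v|[v v']] //=.
  by move=> ->; case: eqP => // -[e]; rewrite e eqxx in nba.
have -> : pull (mcoeff^~ p) (inl a) m' = 0.
  rewrite /pull coef0 ?if_same // => v vb; exact: m'0.
rewrite add0r big1 ?addr0 // => e eb; rewrite /pull coef0 ?mulr0 ?if_same //.
move=> v vb; rewrite cmM m'0 // cmU addn0; case: v vb => [v|[v v']] //= ->.
by rewrite -[_ == _]/(e == b) (negPf eb).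
Qed.

Definition word_poly u : P := actw heis u 1.

Lemma mcoeff_mon w : normal w -> (word_poly w)@_(mon w) = 1.
Proof.
move=> nw; elim/(@normal_ind _ I): w / nw => [|a s n1 nd IHs|a b s n1 ba IHs].
- by rewrite mcoeff1 eqxx.
- rewrite mon_single // mcoeff_heis_single // => e.
  by have := mon_single0 e n1 nd; rewrite mon_single // cmM cmU.
- rewrite mon_pair // mcoeff_heis_pair // => v.
  exact: leader_mon_tail n1 ba.
Qed.

(** The grading for which [word_poly u] is homogeneous of degree the length of
    [u]. *)
Definition weight m : nat :=
  \sum_(v <- finsupp m) m v * (if v is inl _ then 1 else 2).

Lemma weightM m n : weight (m * n)%M = (weight m + weight n)%N.
Proof.
have E (D : {fset V}) (k : {cmonom V}) : (finsupp k `<=` D)%fset ->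
    weight k = (\sum_(v <- D) k v * (if v is inl _ then 1 else 2))%N.
  move=> le; rewrite /weight (big_fset_incl _ le) // => v _.
  by rewrite -cmE_eq0 => /eqP->.
rewrite (E _ m (fsubsetUl (finsupp m) (finsupp n))).
rewrite (E _ n (fsubsetUr (finsupp m) (finsupp n))) /weight mdomD -big_split.
by apply: eq_bigr => v _; rewrite cmM mulnDl.
Qed.

Lemma weightU v : weight (ucm v) = if v is inl _ then 1%N else 2%N.
Proof. by rewrite /weight mdomU big_seq_fset1 cmUU mul1n. Qed.

Lemma weight1 : weight mone = 0%N.
Proof. by rewrite /weight mdom1 big_seq_fset0. Qed.

Lemma weight_mon w : weight (mon w) = size w.
Proof.
have [n] := ubnP (size w); elim: n w => // n IHn [|a s] le_n.
  exact: weight1.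
have [|nd] := boolP (descent (a :: s)); last first.
  by rewrite mon_single // weightM weightU IHn.
case: s le_n => // b s le_n ba.
by rewrite mon_pair // weightM weightU IHn //; exact: ltnW.
Qed.

Lemma word_poly_weight u m : (word_poly u)@_m != 0 -> weight m = size u.
Proof.
elim: u m => [|a u IHu] m.
  by rewrite mcoeff1; case: (m =P mone) => [-> _|_ /eqP//]; apply: weight1.
case/mcoeff_heis_neq0=> [[n -> /IHu e]|[b [n [_ -> /IHu]]]].
  by rewrite weightM weightU e.
by rewrite !weightM !weightU /= => <-.
Qed.

(** Compare [u] with [w] block by block.  A letter read in [u] is the leader of
    an available variable, so it is at least the first letter [a] of [w]; if it
    is [a] itself and [w] starts with a descent [ab], then the next letter of [u]
    is either at least [a], hence larger than [b], or the [c] of a matched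
    [y_ac], which is at least [b].  In the case of equality the same block can be
    removed on both sides. *)
Lemma word_poly_ge w u : normal w -> (word_poly u)@_(mon w) != 0 ->
  ((w : seqlexi I) <= u)%O.
Proof.
move=> nw; elim/(@normal_ind _ I): w / nw u =>
  [u _|a s n1 nd IHs u|a b s n1 ba IHs u].
- by case: u.
- case: u => [|e u nz].
    by move/word_poly_weight; rewrite weight_mon.
  rewrite lexi_cons.
  have [v /(leader_mon n1) av ev] := mcoeff_heis_leader nz.
  rewrite -ev av /=; apply/implyP; rewrite ev => ea.
  have {v ev av ea} ea : e = a by apply: le_anti; rewrite ea -ev av.
  subst e; case/mcoeff_heis_neq0: nz => [[n] | [c [n [_ E _]]]].
    by rewrite mon_single // => /ucmI <- /IHs.
  by have := mon_single0 c n1 nd; rewrite E cmM cmUU.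
- case: u => [|e u nz].
    by move/word_poly_weight; rewrite weight_mon.
  rewrite lexi_cons.
  have [v /(leader_mon n1) av ev] := mcoeff_heis_leader nz.
  rewrite -ev av /=; apply/implyP; rewrite ev => ea.
  have {v ev av ea} ea : e = a by apply: le_anti; rewrite ea -ev av.
  subst e; have sz := word_poly_weight nz; rewrite weight_mon in sz.
  case: u sz nz => // e u sz nz; rewrite lexi_cons.
  case/mcoeff_heis_neq0: nz => [[n E nz] | [c [n [ca E nz]]]].
    have [v nv ev] := mcoeff_heis_leader nz.
    have ae : (a <= e)%O.
      rewrite -ev; apply: leader_mon n1 _.
      by rewrite E cmM addn_eq0 negb_and nv orbT.
    by have be := lt_le_trans ba ae; rewrite (ltW be) leNgt be.
  have bc : (b <= c)%O by apply: mon_pair_ge n1 _; rewrite E cmM cmUU.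
  have ge v : n v != 0%N -> (a <= leader v)%O.
    move=> nv; apply: leader_mon n1 _.
    by rewrite E cmM addn_eq0 negb_and nv orbT.
  have [v nv ev] := mcoeff_heis_leader nz.
  have [ec|ae] : e = c \/ (a <= e)%O.
    move: nv; rewrite cmM cmU addn_eq0 negb_and eqb0 negbK.
    by case/orP=> [/eqP e'|/ge]; [left; rewrite -ev -e'|right; rewrite -ev].
  - clear v nv ev; rewrite ec bc /=; apply/implyP => cb.
    have {bc cb} cb : c = b by apply: le_anti; rewrite bc cb.
    subst e; rewrite {}cb in E ca nz; rewrite (mon_pair s ba) in E.
    have {}E := ucmI E; subst n.
    apply: IHs; case/mcoeff_heis_neq0: nz => [[n] | [e [n [_ E _]]]].
      by move=> /ucmI <-.
    have : (ucm (inl b) * mon s)%M (inr (b, e)) != 0%N by rewrite E cmM cmUU.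
    by rewrite cmM cmU add0n => /ge /=; rewrite leNgt ba.
  - by have be := lt_le_trans ba ae; rewrite (ltW be) leNgt be.
Qed.

Lemma ideal_lt_not_normal f : ideal_gen gamma3 f -> f != 0 ->
  ~~ normal (lt_mon f).
Proof.
move=> If nz; apply/negP => nw; have := lt_mon_in nz.
rewrite -mcoeff_neq0 => /negP[]; apply/eqP.
(* Isolate the leading term in the coefficient of [mon (lt_mon f)]. *)
have : (act heis 1 f)@_(mon (lt_mon f)) = 0.
  rewrite act_ideal_gamma3 ?mcoeff0 //.
  - exact: heis_opD.
  - by apply: heis_opZ => ? ? ?; apply: pderivZ.
  - move=> a b c p; apply: heis_op_nilpotent; last first.
    + by move=> e b' c' q; apply: etrans (pderiv_pvarM _ _ _) _; exact: addr0.
    + by move=> e b' q; exact: pderiv_pvarM.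
    + by move=> e b' q; exact: pderiv_comm.
    + exact: mem_below.
    + exact: below_uniq.
rewrite /act (raddf_sum (mcoeff _)) (big_fsetD1 (lt_mon f)) ?lt_mon_in //=.
rewrite [X in X + _]mcoeffZ (mcoeff_mon nw) mulr1 big_seq big1.
  by rewrite addr0.
move=> u.
rewrite in_fsetD1 => /andP[ne /lt_mon_max le]; rewrite mcoeffZ.
have [->|nz'] := eqVneq ((actw heis u 1)@_(mon (lt_mon f))) 0.
  exact: mulr0.
case/negP: ne; apply/eqP/deglex_anti; rewrite le deglexE.
by rewrite -(word_poly_weight nz') weight_mon eqxx (word_poly_ge nw nz') orbT.
Qed.

End Rep.

(** * Leading monomials of brackets *)

Section Lead.
Context {K : fieldType} {d : Order.disp_t} {I : orderType d}.
Local Notation A := {malg K[{fmonom I}]}.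
Implicit Types (f g : A) (u v w : {fmonom I}) (i j k : I).

Definition monic_lt f w : Prop :=
  f@_w = 1 /\ (forall u, u \in msupp f -> deglex u w).

Lemma deglex_refl u : deglex u u.
Proof. by have := deglex_total u u; rewrite orbb. Qed.

Lemma monic_lt_mon f w : monic_lt f w -> f != 0 /\ lt_mon f = w.
Proof.
case=> fw le_w.
have wf : w \in msupp f by rewrite -mcoeff_neq0 fw oner_neq0.
have nz : f != 0 by apply: contraTneq wf => ->; rewrite msupp0.
split=> //; apply: deglex_anti.
by rewrite lt_mon_max // le_w // lt_mon_in.
Qed.

Lemma lexi_cat (s1 s2 t1 t2 : seqlexi I) : size s1 = size t1 ->
  (s1 <= t1)%O -> (s2 <= t2)%O -> ((s1 ++ s2 : seqlexi I) <= t1 ++ t2)%O.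
Proof.
elim: s1 t1 => [|x s1 IHs] [|y t1] //= [es].
rewrite !lexi_cons => /andP[-> /implyP le] le2 /=.
by apply/implyP => /le /IHs; apply.
Qed.

Lemma deglexM u v u' v' : deglex u u' -> deglex v v' ->
  deglex (u * v)%M (u' * v')%M.
Proof.
rewrite !deglexE !fmM !size_cat.
case/orP=> [lu|/andP[/eqP eu lu]]; case/orP=> [lv|/andP[/eqP ev lv]].
- by rewrite -addnS leq_add // ltnW.
- by rewrite ev ltn_add2r lu.
- by rewrite eu ltn_add2l lv.
- by rewrite eu ev eqxx ltnn lexi_cat.
Qed.

(** Strict monotonicity of the product of monomials, in the form in which it
    shows that the leading monomial of a product arises in a single way. *)
Lemma deglex_mulI u v u' v' : deglex u u' -> deglex v v' ->
  (u * v)%M = (u' * v')%M -> u = u' /\ v = v'.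
Proof.
move=> lu lv /(congr1 (@fmonom_val I)); rewrite !fmM => e.
have su : size u = size u'.
  have := congr1 size e; rewrite !size_cat.
  have le x y : deglex x y -> (size x <= size y)%N.
    by rewrite deglexE => /orP[/ltnW//|/andP[/eqP->]].
  move=> es; apply/eqP; rewrite eqn_leq le //=.
  by rewrite -(leq_add2r (size v)) es leq_add2l le.
by move/eqP: e; rewrite eqseq_cat // => /andP[/eqP e1 /eqP e2]; split;
   apply/val_inj.
Qed.

Lemma monic_ltM f g w v : monic_lt f w -> monic_lt g v ->
  monic_lt (f * g) (w * v)%M.
Proof.
move=> [fw lf] [gv lg]; split; last first.
  move=> u /msuppM_le [k1 [k2 [/lf l1 /lg l2 ->]]]; exact: deglexM.
have wf : w \in msupp f by rewrite -mcoeff_neq0 fw oner_neq0.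
have vg : v \in msupp g by rewrite -mcoeff_neq0 gv oner_neq0.
rewrite mcoeffMl (big_fsetD1 w) //= (big_fsetD1 v) //= eqxx fw gv mulr1.
rewrite !big_seq !big1 ?addr0 // => [u|u].
  rewrite in_fsetD1 => /andP[ne /lf lu]; rewrite big_seq big1 // => k /lg lk.
  case: eqP => // /(deglex_mulI lu lk) [e _]; by rewrite e eqxx in ne.
rewrite in_fsetD1 => /andP[ne /lg lu].
case: eqP => // /(deglex_mulI (deglex_refl w) lu) [_ e].
by rewrite e eqxx in ne.
Qed.

Lemma monic_ltB f g w v : monic_lt f w -> monic_lt g v -> ~~ deglex w v ->
  monic_lt (f - g) w.
Proof.
move=> [fw lf] [_ lg] nle; split.
  rewrite mcoeffB fw [g@__]mcoeff_outdom ?subr0 //.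
  by apply: contraNN nle => /lg.
have lvw : deglex v w by have := deglex_total v w; rewrite (negPf nle) orbF.
move=> u /(fsubsetP (msuppB_le f g)); rewrite in_fsetU => /orP[/lf//|/lg luv].
exact: deglex_trans luv lvw.
Qed.

Lemma monic_lt_bracket f g w v : monic_lt f w -> monic_lt g v ->
  ~~ deglex (w * v)%M (v * w)%M -> monic_lt (bracket f g) (w * v)%M.
Proof.
move=> lf lg; apply: monic_ltB; exact: monic_ltM.
Qed.

Lemma monic_lt_x i : monic_lt (x_ i : A) (fmu i).
Proof.
split; first exact: mcoeffUU.
by move=> u; rewrite msuppU1 in_fset1 => /eqP->; apply: deglex_refl.
Qed.

Lemma monic_lt_xx i j : (j < i)%O ->
  monic_lt (bracket (x_ i) (x_ j) : A) (fmu i * fmu j)%M.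
Proof.
move=> ji; apply: monic_lt_bracket; try exact: monic_lt_x.
by rewrite deglexE !fmM !fmU /= lexi_cons (leNgt i j) ji.
Qed.

End Lead.

(** * The basis *)

Section Basis.
Context {K : fieldType} {d : Order.disp_t} {I : orderType d}.
Local Notation A := {malg K[{fmonom I}]}.
Implicit Types (f g : A) (u v w : {fmonom I}) (i j k : I).

(** The leading monomial of each bracket is the word of its letters as they are
    written, by [monic_lt_bracket]. *)
Lemma not_normal_basis (w : seq I) : ~~ normal w ->
  exists (g : A) v, [/\ basis g, monic_lt g v & infix (fmonom_val v) w].
Proof.
elim: w => // a w IHw; rewrite [normal _]/= negb_and orbC.
case/orP=> [/IHw [g [v [bg gv vw]]]|nok].
  by exists g, v; split=> //; apply: infix_trans vw (infix_cons _ _).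
suff [g [v [bg gv vw]]] : exists (g : A) v,
    [/\ basis g, monic_lt g v & prefix (fmonom_val v) (a :: w)].
  by exists g, v; split=> //; apply: prefixW.
case: w {IHw} nok => [|b [|c s]] //=; rewrite negb_and negbK.
case/orP=> [/andP[ba ca]|].
  case: (ltgtP b a) ba => // [ba _|eba _]; last first.
    exists (bracket (x_ a) (bracket (x_ a) (x_ c))).
    exists (fmu a * (fmu a * fmu c))%M.
    split; first exact: basis_f''.
      apply: monic_lt_bracket; [exact: monic_lt_x|exact: monic_lt_xx|].
      by rewrite deglexE !fmM !fmU /= !lexi_cons lexx /= (leNgt a c) ca.
    by rewrite !fmM !fmU eba /= !eqxx prefix0s.
  case: (ltgtP c b) => // [cb|bc|ecb].
  - exists (bracket (x_ a) (bracket (x_ b) (x_ c))).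
    exists (fmu a * (fmu b * fmu c))%M.
    split; first exact: basis_g'.
      apply: monic_lt_bracket; [exact: monic_lt_x|exact: monic_lt_xx|].
      by rewrite deglexE !fmM !fmU /= !lexi_cons (leNgt a b) ba.
    by rewrite !fmM !fmU /= !eqxx prefix0s.
  - exists (bracket (bracket (x_ a) (x_ b)) (x_ c)).
    exists ((fmu a * fmu b) * fmu c)%M.
    split; first exact: basis_g''.
      apply: monic_lt_bracket; [exact: monic_lt_xx|exact: monic_lt_x|].
      by rewrite deglexE !fmM !fmU /= !lexi_cons (leNgt a c) ca.
    by rewrite !fmM !fmU /= !eqxx prefix0s.
  - exists (bracket (bracket (x_ a) (x_ b)) (x_ b)).
    exists ((fmu a * fmu b) * fmu b)%M.
    split; first exact: basis_f'.
      apply: monic_lt_bracket; [exact: monic_lt_xx|exact: monic_lt_x|].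
      by rewrite deglexE !fmM !fmU /= !lexi_cons (leNgt a b) ba.
    by rewrite !fmM !fmU ecb /= !eqxx prefix0s.
case: s => // e s; rewrite negbK => /and3P[ba /eqP-> eb].
exists (bracket (bracket (x_ a) (x_ b)) (bracket (x_ a) (x_ e))).
exists ((fmu a * fmu b) * (fmu a * fmu e))%M; split; first exact: basis_h.
  apply: monic_lt_bracket; try exact: monic_lt_xx.
    by apply: monic_lt_xx; apply: lt_trans ba.
  by rewrite deglexE !fmM !fmU /= !lexi_cons lexx /= (leNgt b e) eb.
by rewrite !fmM !fmU /= !eqxx prefix0s.
Qed.

Lemma gamma3_ideal f : gamma3 f -> ideal_gen gamma3 f.
Proof.
by move=> Gf; apply: span_gen; exists 1, f, 1; split=> //; rewrite mul1r mulr1.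
Qed.

Lemma gamma3_bracket f g h : freeLie f -> freeLie g -> freeLie h ->
  ideal_gen gamma3 (bracket (bracket f g) h).
Proof.
move=> Lf Lg Lh; apply: gamma3_ideal; apply: span_gen.
exists (bracket f g), h; split=> //; apply: span_gen.
by exists f, g; split.
Qed.

Lemma basis_ideal g : basis g -> ideal_gen gamma3 g.
Proof.
have X i : freeLie (x_ i : A) by exact: freeLie_gen.
case=> [i j _|i j _|i j k _ _|i j k _ _|i j k _ _].
- exact: gamma3_bracket.
- by rewrite bracketC -scaleN1r; apply: spanZ; exact: gamma3_bracket.
- by rewrite bracketC -scaleN1r; apply: spanZ; exact: gamma3_bracket.
- exact: gamma3_bracket.
- by apply: gamma3_bracket; try exact: X; exact: freeLieB.
Qed.

(** The finiteness of the initial segments is what makes the Heisenberg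
    operators finite sums. *)
Lemma groebner_basis (below : I -> seq I) :
  (forall a, uniq (below a)) -> (forall a b, (b \in below a) = (b < a)%O) ->
  is_groebner (ideal_gen (@gamma3 K d I)) (@basis K d I).
Proof.
move=> below_uniq mem_below; split; first exact: basis_ideal.
move=> f If nz.
have := ideal_lt_not_normal below_uniq mem_below If nz.
move/not_normal_basis=> [g [v [bg /monic_lt_mon [gnz gv] inf]]].
by exists g; rewrite gv.
Qed.
End Basis.

Theorem proposition3p2 (K : fieldType) :
  (forall n : nat, (1 < n)%N ->
     is_groebner (ideal_gen (@gamma3 K _ 'I_n)) (@basis K _ 'I_n)) /\
  is_groebner (ideal_gen (@gamma3 K _ nat)) (@basis K _ nat).
Proof.
split=> [n _|].
  apply: (groebner_basis (below := fun a => [seq b <- enum 'I_n | (b < a)%O])).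
    by move=> a; rewrite filter_uniq ?enum_uniq.
  by move=> a b; rewrite mem_filter mem_enum andbT.
apply: (groebner_basis (below := fun a => iota 0 a)) => [a|a b].
  exact: iota_uniq.
by rewrite mem_iota ltEnat.
Qed.
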